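(* There is no randomized algorithm for oracle-EMB that, for every oracle-EMB instance $I=(E,\mathcal{I},c,T)$, with $n=|E|+1$ and $m=c(E)+1$, runs in time $(n\cdot(T+2)\cdot m)^{O(1)}$.
   Context: A matroid is a pair $(E,\mathcal{I})$ with $E$ finite, $\emptyset\in\mathcal{I}\subseteq 2^E$, $\mathcal{I}$ closed under subsets, and the exchange property (for $A,B\in\mathcal{I}$ with $|A|>|B|$ there is $e\in A\setminus B$ with $B\cup\{e\}\in\mathcal{I}$). A basis is an independent set of maximum cardinality. For $c:E\to\mathbb{N}$ and $S\subseteq E$, $c(S)=\sum_{e\in S}c(e)$. Exact Matroid Basis (EMB): an instance is $(E,\mathcal{I},c,T)$ where $(E,\mathcal{I})$ is a matroid, $c:E\to\mathbb{N}$, $T\in\mathbb{N}$; the question is whether there is a basis $S$ of $(E,\mathcal{I})$ with $c(S)=T$. In oracle-EMB, $E,c,T$ are given explicitly and $\mathcal{I}$ is accessible only via a membership oracle (deciding whether a given $S\subseteq E$ is in $\mathcal{I}$ in one query); running time counts queries plus basic operations. A randomized algorithm for a decision problem returns ''yes'' with probability at least $1/2$ on every yes-instance and returns ''no'' with probability $1$ on every no-instance. *)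

(* Defs.v *)
From HB Require Import structures.
From mathcomp Require Import all_boot all_order all_algebra.

Set Implicit Arguments.
Unset Strict Implicit.
Unset Printing Implicit Defensive.

Record matroid (E : finType) : Type := Matroid {
  indep : {set {set E}};
  indep0 : set0 \in indep;
  indepS : forall A B : {set E}, A \subset B -> B \in indep -> A \in indep;
  indep_exchange : forall A B : {set E},
    A \in indep -> B \in indep -> #|B| < #|A| ->
    exists2 e : E, e \in A :\: B & e |: B \in indep
}.

Definition basis (E : finType) (M : matroid E) (S : {set E}) : Prop :=
  S \in indep M /\ forall A : {set E}, A \in indep M -> #|A| <= #|S|.

Record emb_instance : Type := EMBInstance {
  ground : finType;
  mat : matroid ground;
  cost : ground -> nat;
  target : nat
}.

Definition cost_of (I : emb_instance) (S : {set ground I}) : nat :=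
  \sum_(e in S) cost e.

Definition yes_instance (I : emb_instance) : Prop :=
  exists2 S : {set ground I}, basis (mat I) S & cost_of S = target I.

(* Randomized algorithms with a membership oracle are programs of a unit-cost
   random access machine.  The memory is an infinite array M of natural
   numbers, and the arguments of type [nat] below are addresses, except for
   the value v of [IConst] and the jump target l. *)
Inductive instr : Type :=
  | IConst (d v : nat)    (* M[d] := v *)
  | IAdd (d a b : nat)    (* M[d] := M[a] + M[b] *)
  | ISub (d a b : nat)    (* M[d] := M[a] - M[b], truncated at 0 *)
  | IMul (d a b : nat)    (* M[d] := M[a] * M[b] *)
  | IDiv (d a b : nat)    (* M[d] := floor (M[a] / M[b]), and 0 if M[b] = 0 *)
  | ILoad (d a : nat)     (* M[d] := M[M[a]] *)
  | IStore (d a : nat)    (* M[M[d]] := M[a] *)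
  | IJumpZero (a l : nat) (* if M[a] = 0, continue at instruction l *)
  | ICoin (d : nat)       (* M[d] := fair random bit *)
  | IQuery (d a : nat)    (* M[d] := 1 if the set with characteristic vector
                            M[p], ..., M[p + |E| - 1], where p = M[a] and
                            nonzero means member, is independent; else 0 *)
  | IReturn (answer : bool).

Definition program : Type := seq instr.

Definition memory : Type := nat -> nat.

Definition upd (m : memory) (d v : nat) : memory :=
  fun x => if x == d then v else m x.

Inductive config : Type :=
  | Running (pc : nat) (m : memory)
  | Returned (answer : bool).

Definition returned (ans : bool) (s : config) : bool :=
  if s is Returned b then b == ans else false.

Section Semantics.

Variables (E : finType) (oracle : {set E} -> bool) (P : program).

(* The elements of E are handled by the machine through their rank in
   [enum E]. *)
Definition query_set (m : memory) (p : nat) : {set E} :=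
  [set e : E | m (p + enum_rank e) != 0].

Definition exec (coin : bool) (i : instr) (pc : nat) (m : memory) : config :=
  match i with
  | IConst d v => Running pc.+1 (upd m d v)
  | IAdd d a b => Running pc.+1 (upd m d (m a + m b))
  | ISub d a b => Running pc.+1 (upd m d (m a - m b))
  | IMul d a b => Running pc.+1 (upd m d (m a * m b))
  | IDiv d a b => Running pc.+1 (upd m d (m a %/ m b))
  | ILoad d a => Running pc.+1 (upd m d (m (m a)))
  | IStore d a => Running pc.+1 (upd m (m d) (m a))
  | IJumpZero a l => Running (if m a == 0 then l else pc.+1) m
  | ICoin d => Running pc.+1 (upd m d coin)
  | IQuery d a => Running pc.+1 (upd m d (oracle (query_set m (m a))))
  | IReturn answer => Returned answer
  end.

(* A program counter outside the program means that the machine is stuck and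
   never returns.  The random bit [coin] is ignored unless the current
   instruction is [ICoin]. *)
Definition step (s : config) (coin : bool) : config :=
  if s is Running pc m then
    if onth P pc is Some i then exec coin i pc m else s
  else s.

End Semantics.

(* Input: M[0] = |E|, M[1] = T and M[2 + i] = c(e_i), where e_i is the element
   of E of rank i; all other cells are 0. *)
Definition input (I : emb_instance) : memory :=
  fun x => nth 0 [:: #|ground I|, target I
                   & [seq cost e | e <- enum (ground I)]] x.

(* The configuration after [size w] steps, where w.[i] is the coin of step i.
   The matroid enters only as the oracle. *)
Definition run (P : program) (I : emb_instance) (w : seq bool) : config :=
  foldl (step (fun S => S \in indep (mat I)) P) (Running 0 (input I)) w.

Definition returns_within (P : program) (I : emb_instance) (t : nat) : Prop :=
  forall w : t.-tuple bool, exists ans : bool, returned ans (run P I w).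

(* The probability that P answers [ans] within t steps.  Each step has its own
   coin, so t uniform bits cover all the randomness of the first t steps. *)
Definition prob_answer (P : program) (I : emb_instance) (t : nat) (ans : bool)
    : rat :=
  (#|[set w : t.-tuple bool | returned ans (run P I w)]|%:R
     / #|{: t.-tuple bool}|%:R)%R.

Definition randomized_EMB_algorithm (P : program)
    (time : emb_instance -> nat) : Prop :=
  forall I : emb_instance,
    [/\ returns_within P I (time I),
        yes_instance I -> (1 / 2 <= prob_answer P I (time I) true)%R
      & ~ yes_instance I -> prob_answer P I (time I) false = 1%R].

(* Main.v *)
Require Import Defs.
From mathcomp Require Import all_boot all_order all_algebra.
From mathcomp Require Import zify.

(** An injective cost function separates sets that differ by one exchange, so
    the r-subsets of cost exactly T are pairwise at exchange distance at least
    two.  Hence declaring any family of them dependent leaves a (sparse paving)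
    matroid.  Declaring all of them dependent gives a no-instance; sparing a
    single one, S, gives a yes-instance whose oracle differs only at S.  An
    algorithm that never errs on the no-instance must query S on every coin
    sequence for which it accepts the yes-instance, so t steps can serve at
    most 2t choices of S.  Polynomially bounded costs already allow
    exponentially many such S. *)

Set Implicit Arguments.
Unset Strict Implicit.
Unset Printing Implicit Defensive.

(** * Sparse paving matroids *)

Section SparsePaving.

Variables (E : finType) (r : nat) (C : {set {set E}}).
Hypothesis card_C : forall A : {set E}, A \in C -> #|A| = r.
Hypothesis exchange_free : forall (B : {set E}) e1 e2,
  e1 \notin B -> e2 \notin B -> e1 |: B \in C -> e2 |: B \in C -> e1 = e2.

Definition paving_indep : {set {set E}} :=
  [set A : {set E} | (#|A| <= r) && (A \notin C)].

Lemma paving_indepS (A B : {set E}) :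
  A \subset B -> B \in paving_indep -> A \in paving_indep.
Proof.
rewrite !inE => sAB /andP[leBr BnC]; have leAB := subset_leq_card sAB.
rewrite (leq_trans leAB leBr) /=; apply: contra BnC => AC.
suff <- : A = B by [].
by apply/eqP; rewrite eqEcard sAB (card_C AC).
Qed.

(** Adding [e] to [B] can fail only by landing in [C]. Then [A] has [r] elements too and, being
    outside [C], an element [e'] off [e |: B]; [exchange_free] keeps [e' |: B] out of [C]. *)
Lemma paving_exchange (A B : {set E}) :
  A \in paving_indep -> B \in paving_indep -> #|B| < #|A| ->
  exists2 e : E, e \in A :\: B & e |: B \in paving_indep.
Proof.
rewrite !inE => /andP[leAr AnC] /andP[leBr BnC] ltBA.
have [e eA eB] : exists2 e, e \in A & e \notin B.
  apply/subsetPn; apply: contraL ltBA => /subset_leq_card.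
  by rewrite -leqNgt.
have [eBC|eBnC] := boolP (e |: B \in C); last first.
  exists e; rewrite ?inE ?eA ?eB // eBnC cardsU1 eB andbT.
  exact: leq_trans leAr.
have card_eB := card_C eBC.
have [e' e'A] : exists2 e', e' \in A & e' \notin e |: B.
  apply/subsetPn; apply: contra AnC => sAeB.
  suff -> : A = e |: B by [].
  by apply/eqP; rewrite eqEcard sAeB cardsU1 eB.
rewrite !inE negb_or => /andP[e'e e'B].
exists e'; rewrite ?inE ?e'A ?e'B // cardsU1 e'B (leq_trans ltBA leAr) /=.
by apply: contra e'e => /(exchange_free e'B eB)/(_ eBC)->.
Qed.

End SparsePaving.

(** * Matroids that forbid an exact cost *)

Section ExactCost.

Variables (E : finType) (c : E -> nat) (r T : nat).
Hypothesis c_inj : injective c.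

Definition exact_sets : {set {set E}} :=
  [set A : {set E} | (#|A| == r) && (\sum_(e in A) c e == T)].

Variables (spared : {set {set E}}) (A0 : {set E}).
Hypotheses (card_A0 : #|A0| = r) (cost_A0 : \sum_(e in A0) c e != T).

Lemma card_exactD A : A \in exact_sets :\: spared -> #|A| = r.
Proof. by rewrite !inE => /and3P[_ /eqP]. Qed.

Lemma exactD_exchange_free (B : {set E}) e1 e2 :
  e1 \notin B -> e2 \notin B -> e1 |: B \in exact_sets :\: spared ->
  e2 |: B \in exact_sets :\: spared -> e1 = e2.
Proof.
move=> e1B e2B; rewrite !inE !big_setU1 //= => /and3P[_ _ /eqP <-].
by case/and3P=> _ _; rewrite eqn_add2r => /eqP/c_inj.
Qed.

(** Whatever is spared, [A0] makes the empty set independent by heredity; it also pins the rank at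
    [r]. *)
Lemma paving_indep_A0 : A0 \in paving_indep r (exact_sets :\: spared).
Proof. by rewrite !inE card_A0 leqnn (negPf cost_A0) !andbF. Qed.

Definition exact_matroid : matroid E :=
  Matroid (paving_indepS card_exactD (sub0set A0) paving_indep_A0)
          (paving_indepS card_exactD)
          (paving_exchange card_exactD exactD_exchange_free).

End ExactCost.

(** * Runs under two oracles *)

Section Queries.

Variables (E : finType) (P : program).
Implicit Types (o : {set E} -> bool) (s : config) (w : seq bool).

Definition next_query s : seq {set E} :=
  if s is Running pc m then
    if onth P pc is Some (IQuery d a) then [:: query_set E m (m a)] else [::]
  else [::].

Fixpoint queries o s w : seq {set E} :=
  if w is b :: w' then next_query s ++ queries o (step o P s b) w' else [::].

Lemma size_queries o s w : size (queries o s w) <= size w.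
Proof.
elim: w s => //= b w IHw s; rewrite size_cat -add1n leq_add //.
by case: s => //= pc m; case: (onth P pc) => //; case.
Qed.

Lemma eq_step o o' s b : {in next_query s, o =1 o'} ->
  step o P s b = step o' P s b.
Proof.
case: s => //= pc m; case: (onth P pc) => //; case=> //= d a eq_o.
by rewrite eq_o // mem_head.
Qed.

(** Both runs coincide until a query on which the oracles differ, so agreement on the queries made
    under [o] alone suffices. *)
Lemma eq_foldl_step o o' s w : {in queries o s w, o =1 o'} ->
  foldl (step o P) s w = foldl (step o' P) s w.
Proof.
elim: w s => //= b w IHw s eq_o.
rewrite -(@eq_step o o') => [|A sA]; last by rewrite eq_o // mem_cat sA.
by apply: IHw => A wA; rewrite eq_o // mem_cat wA orbT.
Qed.

End Queries.

Lemma prob_answer1 P I t ans (w : t.-tuple bool) :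
  prob_answer P I t ans = 1%R -> returned ans (run P I w).
Proof.
rewrite /prob_answer => prob1.
have T_gt0 : 0 < #|{: t.-tuple bool}| by apply/card_gt0P; exists w.
have /eqP : (#|[set w : t.-tuple bool | returned ans (run P I w)]|%:R
              = #|{: t.-tuple bool}|%:R :> rat)%R.
  apply: (GRing.divIf (y := (#|{: t.-tuple bool}|%:R)%R)).
    by rewrite Num.Theory.pnatr_eq0 -lt0n.
  by rewrite prob1 GRing.divff // Num.Theory.pnatr_eq0 -lt0n.
rewrite Num.Theory.eqr_nat => /eqP cardE.
have /eqP/setP/(_ w) : [set w : t.-tuple bool | returned ans (run P I w)]
          == [set: t.-tuple bool] by rewrite eqEcard subsetT cardsT cardE /=.
by rewrite !inE.
Qed.

Lemma prob_answer_half P I t ans :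
  (1 / 2 <= prob_answer P I t ans)%R ->
  2 ^ t <= 2 * #|[set w : t.-tuple bool | returned ans (run P I w)]|.
Proof.
rewrite /prob_answer card_tuple card_bool => half.
rewrite -(Num.Theory.ler_nat rat) GRing.natrM.
have T_gt0 : (0 < (2 ^ t)%:R :> rat)%R by rewrite Num.Theory.ltr0n expn_gt0.
move: half; rewrite Num.Theory.ler_pdivlMr // GRing.mul1r.
by rewrite Num.Theory.ler_pdivrMl.
Qed.

(** Double counting of the pairs [(j, w)] for which the run on [M0] with coins [w] queries [S j]:
    each [j] has at least half of all [w], each [w] at most [t] of the [j]. *)
Lemma hidden_basis_bound (E J : finType) (c : E -> nat) (T : nat)
    (M0 : matroid E) (M : J -> matroid E) (S : J -> {set E}) P t :
    injective S ->
    (forall j A, A != S j -> (A \in indep (M j)) = (A \in indep M0)) ->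
    prob_answer P (EMBInstance M0 c T) t false = 1%R ->
    (forall j, 1 / 2 <= prob_answer P (EMBInstance (M j) c T) t true)%R ->
  #|J| <= 2 * t.
Proof.
move=> S_inj eqM no_M0 yes_M.
pose I0 := EMBInstance M0 c T.
pose Q (w : t.-tuple bool) :=
  queries P (fun A => A \in indep M0) (Running 0 (input I0)) w.
have accept_query j (w : t.-tuple bool) :
    returned true (run P (EMBInstance (M j) c T) w) -> S j \in Q w.
  (* The input does not depend on the matroid, so without the query [S j] the run repeats the one on
     [M0], which returns false for every [w]. *)
  apply: contraTT => SjQ; have := prob_answer1 w no_M0.
  rewrite {1}/run /= (@eq_foldl_step _ _ _ (fun A => A \in indep (M j))).
    by rewrite /run /=; case: (foldl _ _ _) => //= -[].
  by move=> A AQ; rewrite eqM //; apply: contraNneq SjQ => <-.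
have few_hits w : \sum_(j : J) (S j \in Q w) <= t.
  apply: (@leq_trans (size (Q w))); last first.
    by rewrite (leq_trans (size_queries _ _ _ _)) ?size_tuple.
  rewrite -big_mkcond sum1_card -(card_image S_inj) (leq_trans _ (card_size _)) //.
  by apply/subset_leq_card/subsetP=> _ /imageP[j SjQ ->].
rewrite -(@leq_pmul2r (2 ^ t)) ?expn_gt0 // -sum_nat_const -mulnA.
apply: (@leq_trans (\sum_j 2 * \sum_(w : t.-tuple bool) (S j \in Q w))).
  apply: leq_sum => j _; apply: leq_trans (prob_answer_half (yes_M j)) _.
  rewrite leq_mul2l /= -sum1_card big_mkcond leq_sum // => w _.
  by rewrite inE; case: ifP => // /accept_query->.
rewrite -big_distrr leq_mul2l exchange_big /=.
apply: (@leq_trans (\sum_(w : t.-tuple bool) t)); first by apply: leq_sum.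
by rewrite sum_nat_const card_tuple card_bool mulnC.
Qed.

(** * Small injective costs and the hidden sets *)

Section Gadget.

Variable q : nat.

Let slot : finType := ('I_q * bool)%type.
Let E : finType := (slot * bool)%type.

(** Slot costs are the even numbers below [4 * q]; the last bit in [gadget_cost] then makes all
    element costs distinct. *)
Definition slot_cost (p : slot) : nat := 4 * p.1 + 2 * p.2.
Definition gadget_cost (e : E) : nat := slot_cost e.1 + e.2.

Lemma gadget_cost_inj : injective gadget_cost.
Proof.
move=> [[i b] d] [[i' b'] d']; rewrite /gadget_cost /slot_cost /= => eq_c.
have [-> -> ->] : [/\ i = i', b = b' & d = d'] => //.
by split; [apply: val_inj => /=| |]; move: eq_c; case: b b' d d' => [] [] [] []; lia.
Qed.

(** One of the two elements of each slot is chosen, so the size is fixed and the cost depends only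
    on the number of ones. *)
Definition graph (g : slot -> bool) : {set E} := [set (p, g p) | p : slot].

Lemma graph_pair_inj (g : slot -> bool) : injective (fun p => (p, g p)).
Proof. by move=> p p' []. Qed.

Lemma card_graph g : #|graph g| = q * 2.
Proof.
by rewrite card_imset ?card_prod ?card_ord ?card_bool //; apply: graph_pair_inj.
Qed.

Lemma cost_graph g :
  \sum_(e in graph g) gadget_cost e = \sum_p slot_cost p + \sum_p g p.
Proof.
rewrite big_imset /=; last by move=> p p' _ _; apply: graph_pair_inj.
by rewrite big_split.
Qed.

(* Slot [(i, b)] is given [b (+) f i], so that exactly one of [(i, true)] and
   [(i, false)] carries a 1 and the cost does not depend on [f]. *)
Definition hidden (f : {ffun 'I_q -> bool}) : {set E} :=
  graph (fun p => p.2 (+) f p.1).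

Lemma hidden_inj : injective hidden.
Proof.
move=> f f' eq_ff'; apply/ffunP=> i.
have : ((i, false), f i) \in hidden f' by rewrite -eq_ff'; apply/imsetP; exists (i, false).
by case/imsetP=> -[j b] _ /= [<- <- ->].
Qed.

Lemma cost_hidden f :
  \sum_(e in hidden f) gadget_cost e = \sum_p slot_cost p + q.
Proof.
rewrite cost_graph; congr (_ + _).
rewrite -(pair_bigA _ (fun i b => nat_of_bool (b (+) f i))) /=.
rewrite -[RHS]card_ord -sum1_card; apply: eq_bigr => i _.
by rewrite big_bool; case: (f i).
Qed.

Lemma cost_gadget_bound : \sum_(e in [set: E]) gadget_cost e <= 16 * q ^ 2.
Proof.
apply: (@leq_trans (\sum_(e in [set: E]) 4 * q)).
  apply: leq_sum => -[[i b] d] _; have := ltn_ord i.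
  rewrite /gadget_cost /slot_cost /=; case: b d => [] []; lia.
by rewrite sum_nat_const cardsT !card_prod card_ord card_bool; lia.
Qed.

End Gadget.

(** * Polynomial against exponential growth *)

Lemma leq_exp2rW m n e : m <= n -> m ^ e <= n ^ e.
Proof. by case: e => // e; rewrite leq_exp2r. Qed.

Lemma poly_lt_exp k : exists2 q, 0 < q &
  2 * ((q * 4 + 1) * (16 * q ^ 2 + 2) * (16 * q ^ 2 + 1)) ^ k < 2 ^ q.
Proof.
(* With [q] a power of 2 it suffices to compare exponents: the base is at most [2 ^ 13 * q ^ 5], and
   [(13 + 10 * s) * k + 1 < (s + 1) ^ 2 <= q]. *)
pose s := 13 * k + 1; pose q := 2 ^ (2 * s).
have q_gt0 : 0 < q by rewrite expn_gt0.
exists q => //.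
have base : (q * 4 + 1) * (16 * q ^ 2 + 2) * (16 * q ^ 2 + 1)
    <= 2 ^ (13 + 10 * s).
  have -> : 2 ^ (13 + 10 * s) = (8 * q) * (16 * q ^ 2 * 2) * (16 * q ^ 2 * 2).
    have -> : 10 * s = 2 * s * 5 by lia.
    by rewrite expnD [2 ^ (2 * s * 5)]expnM -/q !expnS expn0; lia.
  by rewrite !leq_mul //; nia.
have lt_s : s.+1 <= 2 ^ s by apply: ltn_expl.
apply: (@leq_ltn_trans (2 * (2 ^ (13 + 10 * s)) ^ k)).
  by rewrite leq_mul2l /= leq_exp2rW //.
rewrite -expnM -expnS ltn_exp2l // /q [2 * s]mulnC expnM.
apply: (@leq_trans (s.+1 ^ 2)); last by rewrite leq_sqr.
rewrite /s; nia.
Qed.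

Theorem theorem1p3 :
  ~ exists (P : program) (k : nat),
      randomized_EMB_algorithm P
        (fun I : emb_instance =>
           let n := #|ground I| + 1 in
           let m := cost_of [set: ground I] + 1 in
           (n * (target I + 2) * m) ^ k).
Proof.
case=> P [k alg]; have [q q_gt0 lt_q] := poly_lt_exp k.
pose r := q * 2; pose T := \sum_p @slot_cost q p + q.
(* No ones are chosen, so the cost falls short of [T] by [q], which is positive. *)
pose A0 := @graph q xpred0.
have card_A0 : #|A0| = r by apply: card_graph.
have cost_A0 : \sum_(e in A0) gadget_cost e != T.
  by rewrite cost_graph [X in _ + X]big1 // eqn_add2l eq_sym -lt0n.
pose M spared := exact_matroid (@gadget_cost_inj q) spared card_A0 cost_A0.
pose I spared := EMBInstance (M spared) (@gadget_cost q) T.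
have no0 : ~ yes_instance (I set0).
  case=> S [S_indep S_max]; rewrite /cost_of /= => S_cost.
  have := S_max A0 (paving_indep_A0 _ card_A0 cost_A0); move: S_indep.
  rewrite !inE S_cost eqxx card_A0 !andbT /= => /andP[leSr neSr] lerS.
  by rewrite eqn_leq leSr lerS in neSr.
have yes1 f : yes_instance (I [set hidden f]).
  exists (hidden f); last exact: cost_hidden.
  split=> [|A]; first by rewrite !inE eqxx card_graph leqnn.
  by rewrite !inE => /andP[leAr _]; rewrite card_graph.
(* The time bound reads only the ground set, costs and target, so all these instances share one
   [t]. *)
have [_ _ /(_ no0) no_prob] := alg (I set0).
have yes_prob f : _ := let: And3 _ h _ := alg (I [set hidden f]) in h (yes1 f).
have eq_indep f A : A != hidden f ->
    (A \in indep (M [set hidden f])) = (A \in indep (M set0)).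
  by rewrite !inE => /negPf->.
have := hidden_basis_bound (@hidden_inj q) eq_indep no_prob yes_prob.
rewrite card_ffun card_bool card_ord leqNgt (leq_ltn_trans _ lt_q) //.
(* [T] is the cost of a hidden set, hence at most that of the whole ground set. *)
have le_T : T <= 16 * q ^ 2.
  apply: leq_trans (cost_gadget_bound q).
  rewrite /T -(cost_hidden [ffun=> false]) [leqRHS](big_setID (hidden [ffun=> false])) /=.
  by rewrite setTI leq_addr.
rewrite leq_mul2l /= leq_exp2rW // !leq_mul ?leq_add2r ?cost_gadget_bound //.
by rewrite !card_prod card_ord card_bool; lia.
Qed.
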